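(* Let $\mathbf{k}=(k_1,\dots,k_m)$ be an index (a tuple of positive integers, $m\ge 1$). Then the following functional equations hold in $\mathcal{A}_{\mathbb{Z}[t]}$: $$\widetilde{\pounds}^{\star}_{\mathcal{A},\mathbf{k}}(t)=\widetilde{\pounds}^{\star}_{\mathcal{A},\mathbf{k}^{\vee}}(1-t)-\zeta^{\star}_{\mathcal{A}}(\mathbf{k}^{\vee}),$$ $$(-1)^{m-1}\pounds_{\mathcal{A},\mathbf{k}}(t)=\widetilde{\pounds}^{\star}_{\mathcal{A},\overline{\mathbf{k}}}(t)+\sum_{j=1}^{m-1}(-1)^j\,\pounds_{\mathcal{A},(k_1,\dots,k_j)}(t)\,\zeta^{\star}_{\mathcal{A}}(k_m,k_{m-1},\dots,k_{j+1}).$$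
   Context: Rings: $\mathcal{A}=\left(\prod_p\mathbb{F}_p\right)/\left(\bigoplus_p\mathbb{F}_p\right)$ and $\mathcal{A}_{\mathbb{Z}[t]}=\left(\prod_p\mathbb{F}_p[t]\right)/\left(\bigoplus_p\mathbb{F}_p[t]\right)$, where $p$ runs over all primes; $\mathcal{A}\subset\mathcal{A}_{\mathbb{Z}[t]}$. Elements are written $(a_p)_p$; two are equal iff their components agree for all but finitely many $p$. For an index $\mathbf{k}=(k_1,\dots,k_m)$ of positive integers: $\zeta^{\star}_{\mathcal{A}}(\mathbf{k})=\Bigl(\sum_{p-1\ge n_1\ge\cdots\ge n_m\ge1}\frac{1}{n_1^{k_1}\cdots n_m^{k_m}}\bmod p\Bigr)_p\in\mathcal{A}$; $\pounds_{\mathcal{A},\mathbf{k}}(t)=\Bigl(\sum_{p>n_1>\cdots>n_m>0}\frac{t^{n_1}}{n_1^{k_1}\cdots n_m^{k_m}}\bmod p\Bigr)_p\in\mathcal{A}_{\mathbb{Z}[t]}$; $\widetilde{\pounds}^{\star}_{\mathcal{A},\mathbf{k}}(t)=\Bigl(\sum_{p-1\ge n_1\ge\cdots\ge n_m\ge1}\frac{t^{n_m}}{n_1^{k_1}\cdots n_m^{k_m}}\bmod p\Bigr)_p\in\mathcal{A}_{\mathbb{Z}[t]}$. $\overline{\mathbf{k}}=(k_m,\dots,k_1)$ is the reversed index. Hoffman dual: let $w=k_1+\cdots+k_m$ be the weight. The map $\psi(k_1,\dots,k_m)=\{k_1,k_1+k_2,\dots,k_1+\cdots+k_{m-1}\}$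 is a bijection from indices of weight $w$ onto subsets of $\{1,\dots,w-1\}$; $\mathbf{k}^{\vee}$ is the index of weight $w$ with $\psi(\mathbf{k}^{\vee})=\{1,\dots,w-1\}\setminus\psi(\mathbf{k})$. *)

(* Defs.v *)
From HB Require Import structures.
From mathcomp Require Import all_boot all_order all_algebra ring_quotient.
From mathcomp Require Import boolp classical_sets functions cardinality.

Set Implicit Arguments.
Unset Strict Implicit.
Unset Printing Implicit Defensive.

Import GRing.Theory.
Local Open Scope ring_scope.
Local Open Scope quotient_scope.

Definition primeT := {p : nat | prime p}.

Definition prodR (R_ : primeT -> comNzRingType) : Type := forall p, R_ p.

Section ProductRing.
Variable R_ : primeT -> comNzRingType.
Local Notation P := (prodR R_).

HB.instance Definition _ := gen_eqMixin P.
HB.instance Definition _ := gen_choiceMixin P.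

Definition prod_zero : P := fun=> 0.
Definition prod_opp (a : P) : P := fun p => - a p.
Definition prod_add (a b : P) : P := fun p => a p + b p.
Definition prod_one : P := fun=> 1.
Definition prod_mul (a b : P) : P := fun p => a p * b p.

Lemma prodRP (a b : P) : (forall p, a p = b p) -> a = b.
Proof. by move=> ab; apply: functional_extensionality_dep. Qed.

Lemma prod_addA : associative prod_add.
Proof. by move=> a b c; apply: prodRP => p; apply: addrA. Qed.
Lemma prod_addC : commutative prod_add.
Proof. by move=> a b; apply: prodRP => p; apply: addrC. Qed.
Lemma prod_add0 : left_id prod_zero prod_add.
Proof. by move=> a; apply: prodRP => p; apply: add0r. Qed.
Lemma prod_addN : left_inverse prod_zero prod_opp prod_add.
Proof. by move=> a; apply: prodRP => p; apply: addNr. Qed.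

HB.instance Definition _ :=
  GRing.isZmodule.Build P prod_addA prod_addC prod_add0 prod_addN.

Lemma prod_mulA : associative prod_mul.
Proof. by move=> a b c; apply: prodRP => p; apply: mulrA. Qed.
Lemma prod_mulC : commutative prod_mul.
Proof. by move=> a b; apply: prodRP => p; apply: mulrC. Qed.
Lemma prod_mul1 : left_id prod_one prod_mul.
Proof. by move=> a; apply: prodRP => p; apply: mul1r. Qed.
Lemma prod_mulD : left_distributive prod_mul prod_add.
Proof. by move=> a b c; apply: prodRP => p; apply: mulrDl. Qed.
Lemma prod_oner_neq0 : prod_one != prod_zero.
Proof.
apply/eqP => /(congr1 (fun a : P => a (exist _ 2%N isT))) /eqP.
by rewrite oner_eq0.
Qed.

HB.instance Definition _ := GRing.Zmodule_isComNzRing.Build P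
  prod_mulA prod_mulC prod_mul1 prod_mulD prod_oner_neq0.

Definition dsum : {pred P} :=
  fun a => `[< finite_set [set p | a p != 0]%classic >].

Lemma primeT_infinite : ~ finite_set [set: primeT].
Proof.
move=> /(finite_image (@proj1_sig nat _)) /finite_seqP[s sE].
have [q q_gt q_prime] := prime_above (\max_(x <- s) x).
have : [set` s]%classic q by rewrite -sE; exists (exist _ q q_prime).
by move=> /= qs; move: q_gt; rewrite ltnNge leq_bigmax_seq.
Qed.

Lemma dsum_idealr : idealr_closed dsum.
Proof.
split=> [||a u v].
- apply/asboolP; apply: (@sub_finite_set _ _ set0) => // p /=.
  by rewrite eqxx.
- apply/negP => /asboolP fin1; apply: primeT_infinite.
  by apply: sub_finite_set fin1 => p _ /=; apply: oner_neq0.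
- move=> /asboolP fu /asboolP fv; apply/asboolP.
  have fuv : finite_set ([set p | u p != 0] `|` [set p | v p != 0])%classic.
    by rewrite finite_setU.
  apply: sub_finite_set fuv => p /= auvp.
  case: (eqVneq (u p) 0) => [u0|]; [right | by left].
  apply: contra auvp => /eqP v0; apply/eqP.
  by change (a p * u p + v p = 0); rewrite u0 v0 mulr0 addr0.
Qed.

HB.instance Definition _ := isIdealr.Build P dsum dsum_idealr.

Definition quotR := {ideal_quot dsum}.
HB.instance Definition _ := GRing.ComNzRing.on quotR.

Definition cls (a : P) : quotR := \pi_{ideal_quot dsum} a.

Lemma clsP (a b : P) :
  cls a = cls b <-> finite_set [set p | a p != b p]%classic.
Proof.
have -> : [set p | a p != b p]%classic = [set p | (a - b) p != 0]%classic.
  by apply/seteqP; split=> p /=; rewrite -(subr_eq0 (a p)).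
rewrite /cls; split=> [/eqP|/asboolP ab].
  by rewrite -Quotient.idealrBE => /asboolP.
by apply/eqP; rewrite -Quotient.idealrBE.
Qed.

Lemma cls_zmod_morphism : zmod_morphism cls.
Proof. by move=> a b; rewrite /cls rmorphB. Qed.

Lemma cls_monoid_morphism : monoid_morphism cls.
Proof. by split=> [|a b]; rewrite /cls (rmorph1, rmorphM). Qed.

HB.instance Definition _ :=
  GRing.isZmodMorphism.Build P quotR cls cls_zmod_morphism.
HB.instance Definition _ :=
  GRing.isMonoidMorphism.Build P quotR cls cls_monoid_morphism.

End ProductRing.

Section Induced.
Variables (R_ S_ : primeT -> comNzRingType).
Variable f : forall p, R_ p -> S_ p.

Definition induced (x : quotR R_) : quotR S_ :=
  cls (fun p => f (repr x p) : S_ p).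

Lemma induced_cls (a : prodR R_) :
  induced (cls a) = cls (fun p => f (a p) : S_ p).
Proof.
apply/clsP; have /clsP : cls (repr (cls a)) = cls a by exact: reprK.
by apply: sub_finite_set => p /=; apply: contra => /eqP ->.
Qed.

End Induced.

Definition Aring : comNzRingType := quotR (fun p => 'F_(val p)).
Definition AringZt : comNzRingType := quotR (fun p => {poly 'F_(val p)}).

Definition A_incl : Aring -> AringZt :=
  induced (fun p (c : 'F_(val p)) => c%:P).

Lemma A_incl_inj : injective A_incl.
Proof.
move=> x y; rewrite -[x]reprK -[y]reprK.
rewrite /A_incl !induced_cls => /clsP xy; apply/clsP.
by apply: sub_finite_set xy => p /=; rewrite (inj_eq (@polyC_inj _)).
Qed.

(* [subst1mt F] is F(1 - t). *)
Definition subst1mt : AringZt -> AringZt :=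
  induced (fun p (g : {poly 'F_(val p)}) => g \Po (1 - 'X)).

Definition is_index (k : seq nat) := (k != [::]) && all (ltn 0) k.

Definition psi (k : seq nat) : seq nat :=
  [seq sumn (take i k) | i <- iota 1 (size k).-1].

(* For 0 < s_1 < ... < s_r < w, [psi_inv w [:: s_1; ...; s_r]] is
   (s_1, s_2 - s_1, ..., w - s_r), the index of weight w with psi = {s_i}. *)
Definition psi_inv (w : nat) (s : seq nat) : seq nat :=
  pairmap (fun x y => (y - x)%N) 0%N (rcons s w).

Definition hoffman_dual (k : seq nat) : seq nat :=
  psi_inv (sumn k) [seq i <- iota 1 (sumn k).-1 | i \notin psi k].

Lemma sumn_pairmap_sub (l : seq nat) (x : nat) : path ltn x l ->
  (x + sumn (pairmap (fun x y => y - x)%N x l) = last x l)%N.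
Proof.
elim: l x => [|y l IH] x /=; first by rewrite addn0.
by move=> /andP[xy yl]; rewrite addnA (subnKC (ltnW xy)) IH.
Qed.

Lemma pairmap_sub_gt0 (l : seq nat) (x : nat) : path ltn x l ->
  all (ltn 0) (pairmap (fun x y => y - x)%N x l).
Proof.
elim: l x => [//|y l IH] x /= /andP[xy yl].
by rewrite subn_gt0 xy IH.
Qed.

Lemma psi_psi_inv (w : nat) (s : seq nat) : path ltn 0%N (rcons s w) ->
  [/\ is_index (psi_inv w s), sumn (psi_inv w s) = w & psi (psi_inv w s) = s].
Proof.
move=> sw; split.
- rewrite /is_index /psi_inv pairmap_sub_gt0 // andbT.
  by rewrite -size_eq0 size_pairmap size_rcons.
- by rewrite -[LHS]add0n sumn_pairmap_sub // last_rcons.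
rewrite /psi /psi_inv size_pairmap size_rcons /=.
apply: (@eq_from_nth _ 0%N); rewrite size_map size_iota // => i i_s.
rewrite (nth_map 0%N) ?size_iota // nth_iota // add1n.
have -> : take i.+1 (pairmap (fun x y => y - x)%N 0%N (rcons s w))
        = pairmap (fun x y => y - x)%N 0%N (take i.+1 s).
  rewrite -cats1 pairmap_cat takel_cat ?size_pairmap //.
  by rewrite -{1}(cat_take_drop i.+1 s) pairmap_cat take_size_cat
       ?size_pairmap ?size_takel.
rewrite -[LHS]add0n sumn_pairmap_sub; last first.
  move: sw; rewrite rcons_path => /andP[+ _].
  by rewrite -{1}(cat_take_drop i.+1 s) cat_path => /andP[].
by rewrite (take_nth 0%N) // last_rcons.
Qed.

Lemma hoffman_dualP (k : seq nat) : is_index k ->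
  [/\ is_index (hoffman_dual k), sumn (hoffman_dual k) = sumn k &
      psi (hoffman_dual k) = [seq i <- iota 1 (sumn k).-1 | i \notin psi k]].
Proof.
move=> /andP[k_nil k_pos]; apply: psi_psi_inv.
have w_gt0 : (0 < sumn k)%N.
  by case: k k_nil k_pos => [//|a k] _ /= /andP[a_gt0 _]; rewrite addn_gt0 a_gt0.
rewrite -cats1 (path_sortedE ltn_trans) all_cat /= w_gt0 /= andbT.
apply/andP; split.
  by rewrite all_filter; apply/allP => i /=; rewrite mem_iota => /andP[-> _];
     rewrite implybT.
rewrite cats1 -cats1 (sorted_pairwise ltn_trans) pairwise_cat /= andbT.
apply/andP; split.
  rewrite allrel1r all_filter; apply/allP => i; rewrite mem_iota add1n.
  by rewrite prednK // => /andP[_ iw] /=; rewrite iw implybT.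
by rewrite -(sorted_pairwise ltn_trans) (sorted_filter ltn_trans) // iota_ltn_sorted.
Qed.

Lemma psi_inj (k l : seq nat) : is_index k -> is_index l ->
  sumn k = sumn l -> psi k = psi l -> k = l.
Proof.
have psi_sum (j : seq nat) i : (i < size j)%N ->
    sumn (take i.+1 j) = nth 0%N (rcons (psi j) (sumn j)) i.
  move=> ij; rewrite nth_rcons size_map size_iota.
  case: ltngtP => [lt_i|gt_i|->].
  - by rewrite (nth_map 0%N) ?size_iota // nth_iota.
  - by move: ij gt_i; case: (size j) => // n; rewrite ltnS ltnNge => ->.
  - by rewrite prednK ?take_size //; apply: leq_ltn_trans ij.
move=> /andP[k0 _] /andP[l0 _] skl pkl.
have size_kl : size k = size l.
  move: (congr1 size pkl); rewrite !size_map !size_iota.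
  by case: k k0 {skl pkl} => // ? ? _; case: l l0 => //= ? ? _ ->.
have take_kl i : (i <= size k)%N -> sumn (take i k) = sumn (take i l).
  case: i => [|i ik]; first by rewrite !take0.
  by rewrite !psi_sum // -?size_kl // pkl skl.
apply: (@eq_from_nth _ 0%N) => // i ik.
have := take_kl i.+1 ik; rewrite !(take_nth 0%N) -?size_kl //.
by rewrite !sumn_rcons take_kl 1?ltnW // => /addnI.
Qed.

(* An index tuple n = (n_1, ..., n_m) ranges over m-tuples of 'I_p, read as
   sequences of naturals below p. *)
Definition nseq_of p m (n : m.-tuple 'I_p) : seq nat := map val n.

Definition strict_dec (n : seq nat) := all (ltn 0) n && sorted gtn n.
Definition weak_dec (n : seq nat) := all (ltn 0) n && sorted geq n.

Definition monomial_inv (F : fieldType) (n k : seq nat) : F :=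
  \prod_(i < size k) (nth 0%N n i)%:R ^- nth 0%N k i.

Definition zeta_star (k : seq nat) : Aring :=
  cls (fun p => \sum_(n : (size k).-tuple 'I_(val p) | weak_dec (nseq_of n))
    monomial_inv 'F_(val p) (nseq_of n) k).

(* Since k is nonempty, [head 0 n] is n_1 and [last 0 n] is n_m. *)
Definition polylog (k : seq nat) : AringZt :=
  cls (fun p => \sum_(n : (size k).-tuple 'I_(val p) | strict_dec (nseq_of n))
    monomial_inv 'F_(val p) (nseq_of n) k *: 'X^(head 0%N (nseq_of n))).

Definition polylog_tilde_star (k : seq nat) : AringZt :=
  cls (fun p => \sum_(n : (size k).-tuple 'I_(val p) | weak_dec (nseq_of n))
    monomial_inv 'F_(val p) (nseq_of n) k *: 'X^(last 0%N (nseq_of n))).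

(* Main.v *)
Require Import Defs.
From HB Require Import structures.
From mathcomp Require Import all_boot all_order all_algebra ring.
Set Implicit Arguments. Unset Strict Implicit.
Import GRing.Theory.
Local Open Scope ring_scope.

(** Both equations already hold in F_p[t] for every prime p, so it suffices to
    compare components.

    Let P_k(t) be the component of the star polylogarithm of k.  Its exponent of
    t is the last summation variable, so P_k obeys a differential recursion on
    the last entry of k: lowering an entry larger than 1 is the operator t d/dt
    ([X_deriv_chain_poly]), and removing a final entry 1 is (t - 1) d/dt up to
    the constant P(1) = zeta star, by summing a geometric progression
    ([subX1_deriv_chain_poly]).  The substitution t -> 1 - t exchanges the
    operators t d/dt and (t - 1) d/dt, and Hoffman duality exchanges the two
    moves on indices ([dual_rcons1], [dual_rconsS]).  Hence, by induction on the
    index, the two sides of the first equation have the same derivative.  Since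
    they have degree less than p, they differ by a constant, and they agree at
    t = 0.  The base case is the index (1), where (t - 1) t P_1'(t) = t^p - t is
    sent to its opposite by t -> 1 - t because of the Frobenius map.

    The second equation holds for sums over any bounded range in any field.
    Reversing an index turns its weakly decreasing chains into weakly increasing
    ones, and sum_(m >= x) = sum_(all m) - sum_(m < x) trades a weakly increasing
    condition for a strictly decreasing one; doing this at each entry in turn
    gives the alternating sum ([leq_gtn_expand]).

    To make both recursions visible, the sums over tuples are first rewritten as
    nested sums ([chain_poly]), in which the variable carrying the power of t
    belongs to the first entry; the star polylogarithm of k is thus attached to
    [rev k]. *)

(** * Hoffman duality as a recursion on the last entry *)

Lemma psi_rcons_of (k : seq nat) (a : nat) : psi (rcons k a) =
  [seq sumn (take i k) | i <- iota 1 (size k)].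
Proof.
rewrite /psi size_rcons /=; apply/eq_in_map => i; rewrite mem_iota => /andP[i1 ik].
by rewrite -cats1 takel_cat // -ltnS.
Qed.

(** The last entry of an index is determined by its weight, and [psi] does not
    record it. *)
Lemma psi_rcons_indep (k : seq nat) (a b : nat) : psi (rcons k a) = psi (rcons k b).
Proof. by rewrite !psi_rcons_of. Qed.

Lemma psi_snoc (k : seq nat) (a : nat) : k != [::] ->
  psi (rcons k a) = rcons (psi k) (sumn k).
Proof.
case: k => [//|b k] _; rewrite psi_rcons_of.
have -> : size (b :: k) = (size k + 1)%N by rewrite addn1.
by rewrite iotaD map_cat cats1 add1n /= take_size.
Qed.

Lemma psi_lt (k : seq nat) i : is_index k -> i \in psi k -> (i < sumn k)%N.
Proof.
case/lastP: k => [//|k a] /andP[_]; rewrite all_rcons psi_rcons_of => /andP[a0 _].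
move=> /mapP[j _ ->].
rewrite sumn_rcons -{2}(cat_take_drop j k) sumn_cat -addnA -[X in (X < _)%N]addn0 ltn_add2l.
by rewrite addn_gt0 (a0 : (0 < a)%N) orbT.
Qed.

Lemma is_index_rcons k a : is_index (rcons k a) = (0 < a)%N && all (ltn 0) k.
Proof. by rewrite /is_index -size_eq0 size_rcons /= all_rcons. Qed.

Lemma iota1_rcons w : (0 < w)%N -> iota 1 w = rcons (iota 1 w.-1) w.
Proof. by case: w => // w _; rewrite -{1}[w.+1]addn1 iotaD cats1 add1n. Qed.

Lemma dual_1 : hoffman_dual [:: 1%N] = [:: 1%N].
Proof. by []. Qed.

(** With w the weight of [k], appending 1 puts w into [psi], hence leaves the
    complement unchanged while the weight grows by one: the dual only has its
    last entry increased. *)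
Lemma dual_rcons1 k a r : is_index k -> hoffman_dual k = rcons r a ->
  hoffman_dual (rcons k 1%N) = rcons r a.+1.
Proof.
move=> kP dk; have [dP dw dpsi] := hoffman_dualP kP.
have k1P : is_index (rcons k 1%N) by rewrite is_index_rcons; case/andP: kP.
have [d1P d1w d1psi] := hoffman_dualP k1P.
move: dP dw dpsi; rewrite dk is_index_rcons => /andP[a0 rP] dw dpsi.
have wpos : (0 < sumn k)%N by rewrite -dw sumn_rcons addn_gt0 a0 orbT.
apply: psi_inj => //.
- by rewrite is_index_rcons.
- by rewrite d1w !sumn_rcons addn1 addnS -dw sumn_rcons.
rewrite d1psi (psi_rcons_indep r _ a) dpsi sumn_rcons addn1 /=.
rewrite psi_snoc; last by case/andP: kP.
rewrite (iota1_rcons wpos) filter_rcons mem_rcons mem_head /=.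
apply: eq_in_filter => i; rewrite mem_iota add1n prednK // => /andP[_ iw].
by rewrite mem_rcons inE ltn_eqF.
Qed.

(** Increasing the last entry leaves [psi] unchanged, so that the old weight
    becomes a new element of the complement: the dual gets a new part 1. *)
Lemma dual_rconsS k a : is_index (rcons k a) ->
  hoffman_dual (rcons k a.+1) = rcons (hoffman_dual (rcons k a)) 1%N.
Proof.
move=> kP; have [dP dw dpsi] := hoffman_dualP kP.
have k1P : is_index (rcons k a.+1) by move: kP; rewrite !is_index_rcons => /andP[].
have [d1P d1w d1psi] := hoffman_dualP k1P.
have wpos : (0 < sumn (rcons k a))%N.
  by move: kP; rewrite is_index_rcons sumn_rcons addn_gt0 => /andP[->]; rewrite orbT.
apply: psi_inj => //.
- by rewrite is_index_rcons; case/andP: dP.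
- by rewrite d1w !sumn_rcons dw sumn_rcons addn1 addnS.
rewrite d1psi (@psi_snoc (hoffman_dual _)) ?dpsi ?dw; last by case/andP: dP.
rewrite (psi_rcons_indep k _ a) sumn_rcons addnS -sumn_rcons /=.
rewrite (iota1_rcons wpos) filter_rcons.
by case: ifP => [|/negbFE /(psi_lt kP)]; last by rewrite ltnn.
Qed.

(** * Nested sums *)

Section Chain.
Variables (F : fieldType) (N : nat).

(** The sum of n_1^-k_1 ... n_m^-k_m over the chains x e n_1 e ... e n_m of
    positive integers below [N]. *)
Fixpoint chain_sum (e : rel nat) (k : seq nat) (x : nat) : F :=
  if k is a :: k' then
    \sum_(m < N | (0 < m)%N && e x m) m%:R ^- a * chain_sum e k' m
  else 1.

(** The same sum with no constraint on n_1, weighted by t^n_1.  The value 0 at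
    the empty index is a dummy. *)
Definition chain_poly (e : rel nat) (k : seq nat) : {poly F} :=
  if k is a :: k' then
    \sum_(m < N | (0 < m)%N) (m%:R ^- a * chain_sum e k' m) *: 'X^m
  else 0.

Lemma monomial_inv_cons x (n : seq nat) a k :
  monomial_inv F (x :: n) (a :: k) = x%:R ^- a * monomial_inv F n k.
Proof. by rewrite /monomial_inv big_ord_recl. Qed.

Lemma monomial_inv_rev n k : size n = size k ->
  monomial_inv F (rev n) (rev k) = monomial_inv F n k.
Proof.
move=> nk; rewrite /monomial_inv size_rev (reindex_inj rev_ord_inj) /=.
apply: eq_bigr => i _; have /= ri := congr1 val (rev_ordK i).
by rewrite !nth_rev ?nk ?(ltn_ord (rev_ord i)) // ri.
Qed.

Lemma big_tuple_cons (V : nmodType) (T : finType) m (P : pred (m.+1.-tuple T))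
    (G : m.+1.-tuple T -> V) :
  \sum_(t | P t) G t =
  \sum_(x : T) \sum_(t : m.-tuple T | P [tuple of x :: t]) G [tuple of x :: t].
Proof.
rewrite pair_big_dep /=.
rewrite (reindex (fun z : T * m.-tuple T => [tuple of z.1 :: z.2])) //=.
exists (fun t => (thead t, [tuple of behead t])) => [[x t]|t] _ /=.
  by congr pair; apply: val_inj.
by rewrite -tuple_eta.
Qed.

(** [path] starts from an arbitrary [x] so that the induction can condition on
    the first component of the tuple. *)
Lemma sum_tuples_path (e : rel nat) (k : seq nat) (x : nat) :
  \sum_(n : (size k).-tuple 'I_N | all (ltn 0) (nseq_of n) && path e x (nseq_of n))
     monomial_inv F (nseq_of n) k = chain_sum e k x.
Proof.
elim: k x => [|a k IH] x /=.
  rewrite (big_pred1 [tuple]) => [|t]; last by rewrite [t]tuple0 /= eqxx.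
  by rewrite /monomial_inv big_ord0.
rewrite big_tuple_cons [RHS]big_mkcond /=; apply: eq_bigr => y _.
rewrite /nseq_of /=; case: ifP => [/andP[y0 exy]|y0exy].
  rewrite -IH big_distrr /=; apply: eq_big => [t|t _]; first by rewrite y0 exy.
  exact: monomial_inv_cons.
by rewrite big_pred0 // => t; apply: contraFF y0exy => /andP[/andP[-> _] /andP[-> _]].
Qed.

Lemma sum_tuples_sorted (e : rel nat) (k : seq nat) : k != [::] ->
  \sum_(n : (size k).-tuple 'I_N | all (ltn 0) (nseq_of n) && sorted e (nseq_of n))
     monomial_inv F (nseq_of n) k *: 'X^(head 0%N (nseq_of n)) = chain_poly e k.
Proof.
case: k => [//|a k _] /=.
rewrite big_tuple_cons [RHS]big_mkcond /=; apply: eq_bigr => y _.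
rewrite /nseq_of /=; case: ifP => [y0|y0].
  rewrite -sum_tuples_path big_distrr scaler_suml /=.
  apply: eq_bigr => t _.
  by rewrite /= monomial_inv_cons.
by rewrite big_pred0 // => t; rewrite /= y0.
Qed.

(** Reversing the tuple and the index moves the exponent of t from the last
    variable to the first. *)
Lemma sum_tuples_weak (k : seq nat) : k != [::] ->
  \sum_(n : (size k).-tuple 'I_N | weak_dec (nseq_of n))
     monomial_inv F (nseq_of n) k *: 'X^(last 0%N (nseq_of n)) = chain_poly leq (rev k).
Proof.
move=> k0; rewrite -sum_tuples_sorted; last by rewrite -size_eq0 size_rev size_eq0.
have rev_inj : injective (@rev_tuple (size k) 'I_N).
  by apply: inv_inj => t; apply: val_inj; apply: revK.
rewrite size_rev (reindex_inj rev_inj).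
have nseq_rev (t : (size k).-tuple 'I_N) : nseq_of (rev_tuple t) = rev (nseq_of t).
  by rewrite /nseq_of map_rev.
apply: eq_big => t.
  rewrite /weak_dec nseq_rev all_rev rev_sorted; congr andb.
move=> _; rewrite nseq_rev -[monomial_inv _ _ (rev k)]monomial_inv_rev;
  last by rewrite size_map size_rev size_tuple.
rewrite revK.
by case: (nseq_of t) => // ? ?; rewrite rev_cons last_rcons.
Qed.

(** The lower bound 0 is vacuous for positive variables, so this is the star sum
    of [rev k]; it equals 1 on the empty index. *)
Definition full_sum k := chain_sum leq k 0.

(** By induction, after writing the outermost sum over m >= x as the sum over all
    m, which is the term j = 0, minus the sum over m < x, in which every term of
    the induction hypothesis gains a factor of index [a]. *)
Lemma leq_gtn_expand k x :
  chain_sum leq k x =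
  \sum_(j < (size k).+1) (-1) ^+ j * chain_sum gtn (take j k) x * full_sum (drop j k).
Proof.
elim: k x => [|a k IH] x; first by rewrite big_ord1 /= /full_sum /= !mulr1.
rewrite big_ord_recl /= expr0 !mul1r.
rewrite {1}/full_sum /= [X in _ = X + _](bigID (fun m : 'I_N => x <= m)%N) /=.
rewrite -[LHS]addr0 -addrA; congr (_ + _); first by apply: eq_bigl => m; rewrite leq0n andbT.
symmetry; rewrite (eq_bigr (fun m : 'I_N => \sum_(j < (size k).+1)
   (-1) ^+ j * (m%:R ^- a * chain_sum gtn (take j k) m) * full_sum (drop j k))); last first.
  move=> m _; rewrite IH big_distrr; apply: eq_bigr => j _ /=.
  by rewrite !mulrA [m%:R ^- a * _]mulrC.
rewrite exchange_big /= -big_split /= big1 // => j _.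
rewrite /bump /= add1n exprS mulN1r !mulNr; apply/eqP; rewrite subr_eq0; apply/eqP.
rewrite mulr_sumr mulr_suml; apply: eq_bigl => m.
by rewrite /= -ltnNge leq0n andbT.
Qed.

(** [leq_gtn_expand] for the tail of [k] gives the coefficients of this
    identity: its last term gives the left-hand side, and its other terms are
    the opposites of those of the sum on the right, where j is one larger. *)
Lemma chain_poly_expand k : k != [::] ->
  (-1) ^+ (size k).-1 * chain_poly gtn k = chain_poly leq k +
  \sum_(1 <= j < size k) (-1) ^+ j * chain_poly gtn (take j k) * (full_sum (drop j k))%:P.
Proof.
case: k => [//|a k _].
rewrite big_add1 /= big_mkord /=.
rewrite [X in _ = X + _](eq_bigr (fun m : 'I_N => \sum_(j < (size k).+1)
  (-1) ^+ j * (m%:R ^- a * chain_sum gtn (take j k) m * full_sum (drop j k)) *: 'X^m)); last first.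
  move=> m _; rewrite leq_gtn_expand big_distrr scaler_suml; apply: eq_bigr => j _ /=.
  by rewrite !mulrA [m%:R ^- a * _]mulrC.
rewrite exchange_big /= big_ord_recr /= addrAC -big_split /=.
have scale_sign j (u t : F) q :
    ((-1) ^+ j * (u * t)) *: q = (-1) ^+ j * (u *: q) * t%:P :> {poly F}.
  rewrite -!mul_polyC !polyCM polyC_exp polyCN -!mulrA.
  by congr (_ * (_ * _)); apply: mulrC.
rewrite take_size drop_size [X in _ = X + _]big1 ?add0r => [|j _].
  rewrite mulr_sumr; apply: eq_bigr => m _.
  by rewrite scale_sign /full_sum /= mulr1.
rewrite exprS mulN1r !mulNr; apply/eqP; rewrite subr_eq0; apply/eqP.
by rewrite mulr_sumr mulr_suml; apply: eq_bigr => m _; apply: scale_sign.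
Qed.

Lemma chain_poly_horner1 k : k != [::] -> (chain_poly leq k).[1] = full_sum k.
Proof.
case: k => [//|a k _]; rewrite /full_sum /= horner_sum; apply: eq_big => m; first by rewrite andbT.
by rewrite hornerZ hornerXn expr1n mulr1.
Qed.

End Chain.

(** * Duality modulo p *)

Section Duality.
Variables (F : fieldType) (p : nat).
Hypothesis pcharF : p \in [pchar F].
Notation P := (chain_poly F p leq).

Let p_pr : prime p := pcharf_prime pcharF.

Lemma natf_neq0 m : (0 < m)%N -> (m < p)%N -> m%:R != 0 :> F.
Proof.
move=> m0 mp; rewrite -(dvdn_pcharf pcharF); apply: contraL mp => /(dvdn_leq m0).
by rewrite -leqNgt.
Qed.

(** The factor m in the derivative of t^m is invertible for 0 < m < p. *)
Lemma deriv0_const (q : {poly F}) : (size q <= p)%N -> q^`() = 0 -> q = (q`_0)%:P.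
Proof.
move=> qp dq; apply/polyP => -[|i]; rewrite coefC //=.
case: (leqP p i.+1) => ip; first by rewrite nth_default // (leq_trans qp).
have /eqP := congr1 (fun r : {poly F} => r`_i) dq.
rewrite coef_deriv coef0 -mulr_natr mulf_eq0 => /orP[/eqP //|].
by rewrite (negbTE (natf_neq0 _ ip)).
Qed.

Lemma size_chain_poly e k : (size (chain_poly F p e k) <= p)%N.
Proof.
case: k => [|a k] /=; first by rewrite size_poly0.
apply: (leq_trans (size_sum _ _ _)); apply/bigmax_leqP => m _.
by apply: (leq_trans (size_scale_leq _ _)); rewrite size_polyXn.
Qed.

Lemma chain_poly_horner0 e k : (chain_poly F p e k).[0] = 0.
Proof.
case: k => [|a k] /=; first by rewrite horner0.
rewrite horner_sum big1 // => m m0.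
by rewrite hornerZ hornerXn expr0n (gtn_eqF m0) mulr0.
Qed.

Lemma deriv_chain_poly e a k : (chain_poly F p e (a :: k))^`() =
  \sum_(m < p | (0 < m)%N) (m%:R ^- a * chain_sum F p e k m * m%:R) *: 'X^(m.-1).
Proof.
rewrite /= raddf_sum; apply: eq_bigr => m m0 /=.
by rewrite derivZ derivXn -scaler_nat scalerA.
Qed.

Lemma X_deriv_chain_poly e a k :
  'X * (chain_poly F p e (a.+1 :: k))^`() = chain_poly F p e (a :: k).
Proof.
rewrite deriv_chain_poly mulr_sumr /=; apply: eq_bigr => m m0.
rewrite -scalerAr -exprS (prednK m0); congr (_ *: _).
have mF := natf_neq0 m0 (ltn_ord m).
by rewrite mulrAC exprSr invfM divfK.
Qed.

(** The final factor m^-1 cancels against the derivative of t^m.  Exchanging the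
    sums then leaves, in front of the coefficient of t^l in [P k], the progression
    1 + t + ... + t^(l-1) = (t^l - 1) / (t - 1). *)
Lemma subX1_deriv_chain_poly k : k != [::] ->
  ('X - 1) * (P (1%N :: k))^`() = P k - (P k).[1]%:P.
Proof.
move=> k0; rewrite chain_poly_horner1 // deriv_chain_poly.
case: k k0 => [//|b k _]; rewrite /full_sum [chain_sum _ _ _ (_ :: _) 0]/= raddf_sum /=.
rewrite [X in _ = _ - X](eq_bigl (fun m : 'I_p => 0 < m)%N) => [|m]; last by rewrite andbT.
rewrite -sumrB.
under eq_bigr => m m0.
  rewrite expr1 mulrAC mulVf ?natf_neq0 // mul1r scaler_suml.
  over.
rewrite (exchange_big_dep (fun l : 'I_p => (0 < l)%N)) /=; last first.
  by move=> m l _ /andP[].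
rewrite mulr_sumr; apply: eq_bigr => l l0.
rewrite -scaler_sumr -scalerAr -[(_ * _)%:P]mulr1 mul_polyC -scalerBr subrX1; congr (_ *: (_ * _)).
transitivity (\sum_(1 <= i < l.+1) 'X^(i.-1) : {poly F}).
  rewrite (big_nat_widen _ _ _ _ _ (ltn_ord l)) (big_nat_widenl _ 0%N) //.
  by rewrite big_mkord; apply: eq_bigl => m; rewrite l0 ltnS andbC.
by rewrite big_add1 big_mkord.
Qed.

(** The base case of the duality.  Here t P' = t + ... + t^(p-1), so that
    (t - 1) t P' = t^p - t.  Under t -> 1 - t the factor t (t - 1) is invariant,
    while t^p - t changes sign because (1 - t)^p = 1 - t^p. *)
Lemma chain_poly_dual1 : (P [:: 1%N])^`() = - ((P [:: 1%N])^`() \Po (1 - 'X)).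
Proof.
have frob (q : {poly F}) : (1 - q) ^+ p = 1 - q ^+ p.
  have pcharP : p \in [pchar {poly F}] by rewrite pchar_poly.
  by rewrite -!(pFrobenius_autE pcharP) rmorphB rmorph1.
have XX1 : ('X - 1) * ('X * (P [:: 1%N])^`()) = 'X^p - 'X.
  rewrite X_deriv_chain_poly /=.
  rewrite (eq_bigr (fun m : 'I_p => 'X^m)) => [|m _]; last first.
    by rewrite expr0 invr1 mulr1 scale1r.
  have := subrX1 ('X : {poly F}) p.
  rewrite [X in _ * X](bigD1 (Ordinal (prime_gt0 p_pr))) //=.
  rewrite [X in _ * (_ + X)](eq_bigl (fun m : 'I_p => 0 < m)%N) => [|m]; last first.
    by rewrite lt0n -val_eqE.
  rewrite expr0 mulrDr mulr1 => geom; apply: (addrI ('X - 1)).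
  by rewrite -geom [RHS]addrC subrKA.
move: (P [:: 1%N])^`() XX1 => D XX1.
apply: (@mulfI _ 'X); first by rewrite polyX_eq0.
apply: (@mulfI _ ('X - 1)); first by rewrite polyXsubC_eq0.
have := congr1 (comp_poly (1 - 'X)) XX1.
rewrite !comp_polyM !comp_polyB comp_polyX comp_polyC rmorphXn /= comp_polyX frob => XX1comp.
rewrite XX1 -[LHS]opprK opprB.
have -> : 'X - 'X^p = 1 - 'X^p - (1 - 'X) :> {poly F} by ring.
by rewrite -XX1comp polyC1; ring.
Qed.

(** The duality equation, for indices given in reversed order. *)
Definition dual_pair r s := P r = P s \Po (1 - 'X) - (P s).[1]%:P.

Lemma size_1subX : size (1 - 'X : {poly F}) = 2.
Proof. by rewrite -opprB size_polyN size_XsubC. Qed.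

Lemma comp_1subXK (q : {poly F}) : (q \Po (1 - 'X)) \Po (1 - 'X) = q.
Proof. by rewrite -comp_polyA comp_polyB comp_polyX comp_polyC subKr comp_polyXr. Qed.

(** Both sides have degree less than p and vanish at 0, so their derivatives
    decide. *)
Lemma dual_pair_deriv r s :
  (P r)^`() = - ((P s)^`() \Po (1 - 'X)) -> dual_pair r s.
Proof.
move=> drs; apply/eqP; rewrite -subr_eq0.
set q := P r - _.
have qp : (size q <= p)%N.
  rewrite (leq_trans (size_polyD _ _)) // geq_max size_chain_poly size_polyN.
  rewrite (leq_trans (size_polyD _ _)) // geq_max size_comp_poly2 ?size_1subX //.
  rewrite size_chain_poly size_polyN (leq_trans (size_polyC_leq1 _)) //.
  exact: prime_gt0.
rewrite (deriv0_const qp).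
  rewrite -horner_coef0 /q !hornerE horner_comp !hornerE !chain_poly_horner0 subr0.
  by rewrite subrr subrr.
rewrite /q !derivB derivC drs deriv_comp !derivE.
by rewrite sub0r mulrN1 !subr0 subrr.
Qed.

(** Evaluating the equation at t = 1 gives P_r(1) = - P_s(1), the duality of the
    star sums themselves; substituting 1 - t then exchanges the roles. *)
Lemma dual_pair_sym r s : dual_pair r s -> dual_pair s r.
Proof.
rewrite /dual_pair => rs.
have -> : (P r).[1] = - (P s).[1].
  by rewrite rs !hornerE horner_comp !hornerE subrr chain_poly_horner0 sub0r.
by rewrite rs comp_polyB comp_1subXK comp_polyC polyCN opprK subrK.
Qed.

(** One step of the duality: t d/dt brings the left-hand index back to [a :: r],
    and t -> 1 - t turns this operator into (t - 1) d/dt, which removes the 1 on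
    the right.  The mirror step follows by [dual_pair_sym]. *)
Lemma dual_pair_step a r s : s != [::] ->
  dual_pair (a :: r) s -> dual_pair (a.+1 :: r) (1%N :: s).
Proof.
move=> s0 rs; apply: dual_pair_deriv.
apply: (@mulfI _ 'X); first by rewrite polyX_eq0.
rewrite X_deriv_chain_poly rs.
have -> : P s \Po (1 - 'X) - (P s).[1]%:P = (P s - (P s).[1]%:P) \Po (1 - 'X).
  by rewrite comp_polyB comp_polyC.
rewrite -subX1_deriv_chain_poly // comp_polyM mulrN -mulNr; congr (_ * _).
by rewrite comp_polyB comp_polyX comp_polyC addrAC subrr sub0r.
Qed.

(** Every index arises from (1) by appending 1 and by increasing the last entry;
    the dual undergoes the mirror moves. *)
Lemma dual_pair_hoffman k : is_index k -> dual_pair (rev k) (rev (hoffman_dual k)).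
Proof.
elim/last_ind: k => [//|k a IHk].
elim: a => [|a IHa] kP; first by move: kP; rewrite is_index_rcons.
have kpos : all (ltn 0) k by move: kP; rewrite is_index_rcons.
case: a IHa kP => [_ _|a IHa _]; last first.
  have aP : is_index (rcons k a.+1) by rewrite is_index_rcons.
  have [dP _ _] := hoffman_dualP aP.
  rewrite dual_rconsS // !rev_rcons; apply: dual_pair_step; last first.
    by rewrite -rev_rcons; apply: IHa.
  by rewrite -size_eq0 size_rev size_eq0; case/andP: dP.
have [->|k0] := eqVneq k [::].
  by rewrite dual_1; apply: dual_pair_deriv; apply: chain_poly_dual1.
have kP : is_index k by rewrite /is_index k0.
have [dP _ _] := hoffman_dualP kP.
case/lastP dk : (hoffman_dual k) dP => [//|r b] _.
rewrite (dual_rcons1 kP dk) !rev_rcons; apply/dual_pair_sym/dual_pair_step.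
  by rewrite -size_eq0 size_rev size_eq0.
by rewrite -rev_rcons -dk; apply/dual_pair_sym/IHk.
Qed.

End Duality.

(** * From components to the quotient rings *)

Section ProductComponents.
Variable R_ : primeT -> comNzRingType.

Lemma prodR_sumE (I : Type) (r : seq I) (Q : pred I) (f : I -> prodR R_) p :
  (\sum_(i <- r | Q i) f i) p = \sum_(i <- r | Q i) f i p.
Proof. by apply: (big_morph (fun a : prodR R_ => a p)). Qed.

Lemma prodR_signE n p : ((-1) ^+ n : prodR R_) p = (-1) ^+ n.
Proof. by elim: n => [//|n IH]; rewrite !exprS -IH. Qed.

End ProductComponents.

Definition clsZt (f : forall p : primeT, {poly 'F_(val p)}) : AringZt :=
  cls (f : prodR (fun p => {poly 'F_(val p)})).

Lemma polylogE k : k != [::] ->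
  polylog k = clsZt (fun p => chain_poly 'F_(val p) (val p) gtn k).
Proof.
by move=> k0; congr cls; apply: prodRP => p; apply: sum_tuples_sorted.
Qed.

Lemma polylog_tilde_starE k : k != [::] ->
  polylog_tilde_star k =
  clsZt (fun p => chain_poly 'F_(val p) (val p) leq (rev k)).
Proof.
by move=> k0; congr cls; apply: prodRP => p; apply: sum_tuples_weak.
Qed.

Lemma zeta_starE k : k != [::] ->
  A_incl (zeta_star k) =
  clsZt (fun p => (chain_poly 'F_(val p) (val p) leq (rev k)).[1]%:P).
Proof.
move=> k0; rewrite /A_incl induced_cls; congr cls; apply: prodRP => p.
rewrite -sum_tuples_weak // horner_sum; congr polyC; apply: eq_bigr => n _.
by rewrite hornerZ hornerXn expr1n mulr1.
Qed.

Theorem theorem1p3 (k : seq nat) (hk : is_index k) :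
  polylog_tilde_star k
    = subst1mt (polylog_tilde_star (hoffman_dual k))
      - A_incl (zeta_star (hoffman_dual k))
  /\
  (-1) ^+ (size k).-1 * polylog k
    = polylog_tilde_star (rev k)
      + \sum_(1 <= j < size k)
          (-1) ^+ j * polylog (take j k) * A_incl (zeta_star (rev (drop j k))).
Proof.
have [k0 _] := andP hk; have [/andP[d0 _] _ _] := hoffman_dualP hk.
have rev0 l : l != [::] :> seq nat -> rev l != [::].
  by rewrite -!size_eq0 size_rev.
split.
  rewrite !polylog_tilde_starE // zeta_starE // /subst1mt /clsZt induced_cls -rmorphB.
  congr cls; apply: prodRP => p.
  exact: (dual_pair_hoffman (pchar_Fp (valP p)) hk).
rewrite polylogE // polylog_tilde_starE ?rev0 // revK.
rewrite (eq_big_nat _ _ (F2 := fun j => cls (fun p => (-1) ^+ j *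
  chain_poly 'F_(val p) (val p) gtn (take j k) *
  (full_sum 'F_(val p) (val p) (drop j k))%:P) : AringZt)); last first.
  move=> j /andP[j0 jk].
  have takej0 : take j k != [::] by rewrite -size_eq0 size_takel ?(ltnW jk) // -lt0n.
  have dropj0 : drop j k != [::] by rewrite -size_eq0 size_drop subn_eq0 -ltnNge.
  rewrite polylogE // zeta_starE ?rev0 // revK /clsZt.
  rewrite -[(-1) ^+ j](rmorph_sign (@cls (fun p => {poly 'F_(val p)}))) -!rmorphM.
  congr cls; apply: prodRP => p; rewrite -chain_poly_horner1 //.
  by congr (_ * _ * _); apply: prodR_signE.
rewrite -[(-1) ^+ _](rmorph_sign (@cls (fun p => {poly 'F_(val p)}))) /clsZt.
rewrite -rmorph_sum -rmorphM -rmorphD; congr cls; apply: prodRP => p.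
transitivity ((-1) ^+ (size k).-1 * chain_poly 'F_(val p) (val p) gtn k).
  by congr (_ * _); apply: prodR_signE.
rewrite chain_poly_expand //; congr (_ + _).
by rewrite prodR_sumE.
Qed.
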